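(* Let $Q_0,Q_1,\dots,Q_n$ be a finite chain (of events of a path $Q$). Then for all indices $i,j,l$, $$0\le i<j<l\le n\implies [Q_i\;Q_j\;Q_l].$$ Furthermore, all events of the chain are distinct: $Q_i\neq Q_j$ whenever $0\le i<j\le n$.
   Context: Let $\mathcal E$ be a set, whose elements are called events; let $\mathcal P$ be a set of subsets of $\mathcal E$, whose elements are called paths; and let $[\,\cdot\;\cdot\;\cdot\,]$ be a ternary relation (betweenness) on $\mathcal E$. The following axioms are assumed. (I1) $\mathcal E\neq\emptyset$. (I2) For distinct events $a,b$ there are paths $R\ni a$, $S\ni b$ with $R\cap S\ne\emptyset$. (I3) For any two distinct events there is at most one path containing both. (O1) If $[a\;b\;c]$ then some path contains $a,b,c$. (O2) $[a\;b\;c]\Rightarrow[c\;b\;a]$. (O3) $[a\;b\;c]\Rightarrow a\neq c$. (O4) $[a\;b\;c]$ and $[b\;c\;d]$ imply $[a\;b\;d]$ (no distinctness of $a,d$ is assumed). (O5) If $a,b,c$ are distinct events of one path, then $[a\;b\;c]$ or $[b\;c\;a]$ or $[c\;a\;b]$. In this statement, a finite chain is defined by local ordering only: it is a finite sequence $Q_0,\dots,Q_n$ ($n\ge1$) of events of a path such that either $n=1$ and $Q_0\neq Q_1$, or $n\geq 2$ and $[Q_{i-2}\;Q_{i-1}\;Q_i]$ for all $2\le i\le n$. *)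

(* Defs.v *)
From mathcomp Require Import all_boot.
From mathcomp Require Import boolp classical_sets.

Set Implicit Arguments.
Unset Strict Implicit.
Unset Printing Implicit Defensive.

Local Open Scope classical_set_scope.

(* [path Q]: the subset Q of events is a path.
   [btw a b c]: the betweenness relation [a b c]. *)
Record ordered_paths (E : Type) (path : set (set E)) (btw : E -> E -> E -> Prop)
    : Prop := OrderedPaths {
  ax_I1 : [set: E] !=set0;
  ax_I2 : forall a b, a <> b ->
    exists R S, [/\ path R, path S, R a, S b & R `&` S !=set0];
  ax_I3 : forall a b, a <> b -> forall R S, path R -> path S ->
    R a -> R b -> S a -> S b -> R = S;
  ax_O1 : forall a b c, btw a b c ->
    exists2 R, path R & [/\ R a, R b & R c];
  ax_O2 : forall a b c, btw a b c -> btw c b a;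
  ax_O3 : forall a b c, btw a b c -> a <> c;
  ax_O4 : forall a b c d, btw a b c -> btw b c d -> btw a b d;
  ax_O5 : forall R a b c, path R -> R a -> R b -> R c ->
    a <> b -> b <> c -> a <> c ->
    [\/ btw a b c, btw b c a | btw c a b]
}.

(* The sequence q_0, ..., q_n is a function on 'I_n.+1; three consecutive
   indices i-2, i-1, i are given as ordinals i, j, k with j = i + 1 and
   k = j + 1, so that no truncated subtraction is involved. *)
Definition finite_chain (E : Type) (path : set (set E))
    (btw : E -> E -> E -> Prop) (Q : set E) (n : nat) (q : 'I_n.+1 -> E) : Prop :=
  [/\ path Q, forall i, Q (q i) &
      (n = 1 /\ q ord0 <> q ord_max) \/
      (2 <= n /\ forall i j k : 'I_n.+1,
         j = i.+1 :> nat -> k = j.+1 :> nat -> btw (q i) (q j) (q k))].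

(* Main.v *)
(* O4, applied directly and to the reversed triples, gives the overlap rule:
   [a b c] and [b c d] imply [a b d] and [a c d].  Sliding the last two indices
   along the chain yields [Q_i Q_j Q_(j+1)] for i < j; stretching the last index
   then yields [Q_i Q_j Q_l]. *)
Require Import Defs.
From mathcomp Require Import all_boot.
From mathcomp Require Import boolp classical_sets.

Set Implicit Arguments.
Unset Strict Implicit.
Unset Printing Implicit Defensive.

Section LocalOrder.
Variables (E : Type) (path : set (set E)) (btw : E -> E -> E -> Prop).
Hypothesis ax : ordered_paths path btw.

Lemma btw_overlap a b c d : btw a b c -> btw b c d -> btw a c d.
Proof.
move=> abc bcd; apply: (ax_O2 ax).
exact: (ax_O4 ax (ax_O2 ax bcd) (ax_O2 ax abc)).
Qed.

(** If [a = b], O4 glues the reversed triple [c a a] to [a a c] and gives [c a c], which O3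
    forbids. *)
Lemma btw_neq12 a b c : btw a b c -> a <> b.
Proof.
move=> abc ab; move: abc; rewrite -ab => aac.
exact: (ax_O3 ax (ax_O4 ax (ax_O2 ax aac) aac)).
Qed.

Lemma btw_neq23 a b c : btw a b c -> b <> c.
Proof. by move=> /(ax_O2 ax) /btw_neq12 cb /esym. Qed.

Variables (n : nat) (p : nat -> E).
Hypothesis local : forall i, i.+2 <= n -> btw (p i) (p i.+1) (p i.+2).

Lemma local_order_succ i j : i < j -> j < n -> btw (p i) (p j) (p j.+1).
Proof.
elim: j => // j IHj; rewrite ltnS leq_eqVlt => /predU1P[-> | ij] jn.
  exact: local.
exact: (btw_overlap (IHj ij (ltnW jn)) (local jn)).
Qed.

Lemma local_order_total i j l :
  i < j -> j < l -> l <= n -> btw (p i) (p j) (p l).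
Proof.
move=> ij; elim: l => // l IHl; rewrite ltnS leq_eqVlt => /predU1P[<- | jl] ln.
  exact: local_order_succ.
exact: (ax_O4 ax (IHl jl (ltnW ln)) (local_order_succ jl ln)).
Qed.

(** Since [2 <= n], a third index always completes the pair to an ordered triple, whose members are
    distinct: [n] on the right if [j < n]; otherwise 1 in the middle if [i = 0], and the predecessor
    of [i] on the left if not. *)
Lemma local_order_neq i j : 2 <= n -> i < j -> j <= n -> p i <> p j.
Proof.
move=> n2 ij; rewrite leq_eqVlt => /predU1P[jn | jn]; last first.
  exact: (btw_neq12 (local_order_total ij jn (leqnn n))).
case: i ij => [|i] ij; rewrite jn in ij *.
  exact: (ax_O3 ax (local_order_total (ltn0Sn 0) n2 (leqnn n))).
exact: (btw_neq23 (local_order_total (ltnSn i) ij (leqnn n))).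
Qed.

End LocalOrder.

Theorem theorem2 (E : Type) (path : set (set E)) (btw : E -> E -> E -> Prop)
    (ax : ordered_paths path btw)
    (Q : set E) (n : nat) (q : 'I_n.+1 -> E)
    (chain : finite_chain path btw Q q) :
  (forall i j l : 'I_n.+1, i < j -> j < l -> btw (q i) (q j) (q l)) /\
  (forall i j : 'I_n.+1, i < j -> q i <> q j).
Proof.
case: chain => _ _ [[n1 q01] | [n2 loc]].
  (* For [n = 1] no three indices increase strictly, and the only increasing pair is (0, 1). *)
  subst n; split=> [[[|[|i]] ?] [[|[|j]] ?] [[|[|l]] ?] //|i j ij].
  have -> : i = ord0 by apply: val_inj; case: i j ij => [[|[|i]] ?] [[|[|j]] ?].
  by have -> : j = ord_max by apply: val_inj; case: i j ij => [[|[|i]] ?] [[|[|j]] ?].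
(* Extending the chain to all of [nat] allows induction on plain indices. Beyond [n], [inord] falls
   back to index 0, which is harmless because [local] only concerns indices up to [n]. *)
pose p m := q (inord m).
have pE (i : 'I_n.+1) : q i = p i by rewrite /p inord_val.
have local i : i.+2 <= n -> btw (p i) (p i.+1) (p i.+2).
  move=> i2n; have i1n := ltnW i2n; have i0n := ltnW i1n.
  by apply: loc; rewrite !inordK.
split=> [i j l ij jl | i j ij]; rewrite !pE.
  exact: (local_order_total ax local ij jl (leq_ord l)).
exact: (local_order_neq ax local n2 ij (leq_ord j)).
Qed.
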